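(* Let $\Gamma$ be the mixed graph with vertex set $\mathbb{Z}_{12}$, edges $i\sim i+1$ for all $i\in\mathbb{Z}_{12}$, and arcs $i\to i+4$ for even $i$ and $i\to i-4$ for odd $i$ (so the arcs form the directed $3$-cycles $0\to4\to8\to0$, $2\to6\to10\to2$, $1\to9\to5\to1$, $3\to11\to7\to3$). Then $\Gamma$ is, up to isomorphism, the unique $(2,1,2;+1)$-graph; that is, $\Gamma$ is a $2$-geodetic mixed graph with minimum undirected degree $\ge 2$, minimum directed out-degree $\ge 1$ and order $12$, and every such mixed graph is isomorphic to $\Gamma$.
   Context: A mixed graph $G$ consists of a finite set $V(G)$ of vertices, a set $E(G)$ of unordered pairs of vertices (edges, $u\sim v$) and a set $A(G)$ of ordered pairs (arcs, $u\to v$). There are no loops and no parallel edges or arcs, and $u\sim v$ and $u\to v$ cannot hold simultaneously. The undirected degree of $u$ is $|\{v:u\sim v\}|$ and the directed out-degree is $|\{v:u\to v\}|$. A mixed path of length $t$ is a walk $u_0u_1\dots u_t$ with $u_i\sim u_{i+1}$ or $u_i\to u_{i+1}$ for each $i$ that is non-backtracking, i.e. contains no sub-walk $u_i\sim u_{i+1}\sim u_i$ (length $0$ is allowed). $G$ is $2$-geodetic if for any ordered pair of (not necessarily distinct) vertices $u,v$ there is at most one mixed path from $u$ to $v$ of length $\le 2$. An $(r,z,2;+1)$-graph is a $2$-geodetic mixed graph with minimum undirected degree $\ge r$, minimum directed out-degree $\ge z$ and order $M(r,z,2)+1$, where $M(r,z,2)=(r+z)^2+z+1$; for $r=2$, $z=1$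 the order is $12$. Isomorphisms of mixed graphs are bijections of vertices preserving edges and arcs in both directions. *)

(* Defs.v *)
From mathcomp Require Import all_boot all_algebra.

Set Implicit Arguments.
Unset Strict Implicit.
Unset Printing Implicit Defensive.

Import GRing.Theory.

(* Opposite arcs u -> v and v -> u may coexist in a mixed graph; only an edge
   and an arc on the same pair of vertices are incompatible. *)
Record mixed_graph (V : finType) := MixedGraph {
  mg_edge : rel V;
  mg_arc : rel V;
  mg_edge_sym : symmetric mg_edge;
  mg_edge_irr : irreflexive mg_edge;
  mg_arc_irr : irreflexive mg_arc;
  mg_edge_not_arc : forall u v, ~~ (mg_edge u v && mg_arc u v)
}.

Section MixedGraphs.

Variables (V : finType) (G : mixed_graph V).

Definition step : rel V := fun u v => mg_edge G u v || mg_arc G u v.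

Definition undirected_degree (u : V) : nat := #|[set v | mg_edge G u v]|.

Definition out_degree (u : V) : nat := #|[set v | mg_arc G u v]|.

Fixpoint non_backtracking (s : seq V) : bool :=
  match s with
  | x :: ((y :: z :: _) as s') =>
      ~~ [&& mg_edge G x y, mg_edge G y z & z == x] && non_backtracking s'
  | _ => true
  end.

(* The walk u :: p, of length size p, from u to last u p. Since there are no
   parallel edges or arcs, a walk is determined by its sequence of vertices. *)
Definition mixed_path (u : V) (p : seq V) : bool :=
  path step u p && non_backtracking (u :: p).

Definition geodetic (k : nat) : Prop :=
  forall (u v : V) (p q : seq V),
    mixed_path u p -> last u p = v -> size p <= k ->
    mixed_path u q -> last u q = v -> size q <= k ->
    p = q.

Definition min_undirected_degree_ge (r : nat) : Prop :=
  forall u : V, r <= undirected_degree u.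

Definition min_out_degree_ge (z : nat) : Prop :=
  forall u : V, z <= out_degree u.

End MixedGraphs.

(* The mixed Moore bound M(r, z, 2). *)
Definition moore_bound2 (r z : nat) : nat := (r + z) ^ 2 + z + 1.

(* (r, z, 2; +1)-graphs. *)
Definition excess_one_graph (r z : nat) (V : finType) (G : mixed_graph V)
    : Prop :=
  [/\ geodetic G 2, min_undirected_degree_ge G r, min_out_degree_ge G z
    & #|V| = moore_bound2 r z + 1].

Definition isomorphic (V W : finType) (G : mixed_graph V) (H : mixed_graph W)
    : Prop :=
  exists f : V -> W,
    [/\ bijective f,
        forall u v, mg_edge H (f u) (f v) = mg_edge G u v
      & forall u v, mg_arc H (f u) (f v) = mg_arc G u v].

(* [odd i] is the parity of the representative of i in {0, ..., 11}. *)
Definition Gamma_edge : rel 'Z_12 :=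
  fun i j => ((j == i + 1) || (i == j + 1))%R.

Definition Gamma_arc : rel 'Z_12 :=
  fun i j => (j == if odd i then i - 4 else i + 4)%R.

Lemma Gamma_edge_sym : symmetric Gamma_edge.
Proof. by move=> i j; rewrite /Gamma_edge orbC. Qed.

Lemma Gamma_edge_irr : irreflexive Gamma_edge.
Proof. by case; do 12?case=> //. Qed.

Lemma Gamma_arc_irr : irreflexive Gamma_arc.
Proof. by case; do 12?case=> //. Qed.

Lemma Gamma_edge_not_arc (i j : 'Z_12) : ~~ (Gamma_edge i j && Gamma_arc i j).
Proof.
apply/negP => /andP[edge_ij /eqP def_j]; move: edge_ij; rewrite {j}def_j.
by case: i; do 12?case=> //.
Qed.

Definition Gamma : mixed_graph 'Z_12 :=
  MixedGraph Gamma_edge_sym Gamma_edge_irr Gamma_arc_irr Gamma_edge_not_arc.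

(* Main.v *)
Require Import Defs.
From mathcomp Require Import all_boot all_algebra.
From mathcomp Require Import zify.

(** Fix a vertex u of degree d and out-degree z.  In a 2-geodetic graph the
mixed paths of length at most 2 from u have distinct end points, and the
minimum degree conditions give at least 1 + 3d + 4z of them.  As there are
only 12 vertices, d = 2 and z = 1 everywhere ([moore_bound_at],
[excess_one_degrees]), and the 11 short paths from u form a tree that reaches
all vertices but one.

Calling the vertices of the tree 0, ..., 10 from the root down and the missing
vertex 11, one knows the out-neighbours of 0 and 3 and parts of the others
([tree_labelling]).  What remains is a finite search: the edges at the vertices
4, ..., 11 are guessed one vertex at a time, then their arcs, and a partial
graph is dropped as soon as a vertex has three neighbours or two short paths
with the same ends.  A graph satisfying the hypotheses always follows one of
the surviving branches ([search_sound]).  Four complete graphs survive.  They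
are copies of Gamma ([search_tree]), and there are four of them because the
labelling leaves two choices open: which undirected neighbour of the root is
called 1, and which undirected neighbour of its out-neighbour is called 8.  So
the given graph contains a copy of Gamma on the same vertices, and since the
degrees agree there is no room for further edges or arcs
([bijective_hom_isomorphic]).

That Gamma itself is 2-geodetic is an instance of the test used to drop partial
graphs ([Gamma_geodetic]). *)

Set Implicit Arguments.
Unset Strict Implicit.
Unset Printing Implicit Defensive.

(** * Sequences without repetition *)

Lemma uniq_map_inj_in (T1 T2 : eqType) (f : T1 -> T2) (s : seq T1) :
  uniq (map f s) -> {in s &, injective f}.
Proof.
elim: s => //= x s IHs /andP[x_notin /IHs f_inj] y y'; rewrite !inE.
case/predU1P=> [->|y_s] /predU1P[->|y'_s] // eq_f; last exact: f_inj.
  by case/negP: x_notin; rewrite eq_f map_f.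
by case/negP: x_notin; rewrite -eq_f map_f.
Qed.

Lemma uniq_two_steps (T : eqType) (s : seq T) (t : T -> seq T) :
    uniq s -> {in s, forall x, uniq (t x)} ->
  uniq ([::] :: [seq [:: x] | x <- s] ++ [seq [:: x; y] | x <- s, y <- t x]).
Proof.
move=> s_uniq t_uniq.
rewrite /= cat_uniq map_inj_uniq ?s_uniq; last by move=> x y [].
rewrite allpairs_uniq_dep //; last by move=> [x y] [x' y'] _ _ /= [-> ->].
rewrite mem_cat negb_or !andbT /= -andbA; apply/and3P; split.
- by apply/mapP => -[].
- by apply/negP => /allpairsPdep[x [y []]].
- by apply/hasPn => _ /allpairsPdep[x [y [_ _ ->]]]; apply/mapP => -[].
Qed.

(** * The Moore bound *)

Section Moore.

Variables (V : finType) (G : mixed_graph V).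

Definition continuations (u x : V) : {set V} :=
  [set y | mixed_path G u [:: x; y]].

Lemma arc_not_edge u v : mg_arc G u v -> mg_edge G u v = false.
Proof. by move=> uv; have := mg_edge_not_arc G u v; rewrite uv andbT => /negbTE. Qed.

Lemma edge_neq_arc u v w : mg_edge G u v -> mg_arc G u w -> v != w.
Proof. by move=> uv uw; apply: contraTneq uv => ->; rewrite arc_not_edge. Qed.

Lemma mixed_path1 u x : mixed_path G u [:: x] = step G u x.
Proof. by rewrite /mixed_path /= !andbT. Qed.

Lemma mixed_path2 u x y :
  mixed_path G u [:: x; y] =
  [&& step G u x, step G x y
    & ~~ [&& mg_edge G u x, mg_edge G x y & y == u]].
Proof. by rewrite /mixed_path /= !andbT -andbA. Qed.

(** The form in which the geodetic property is used throughout: listing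
distinct short paths from [u] lists distinct vertices. *)
Lemma geodetic_last_uniq k u ps :
    geodetic G k -> uniq ps ->
    all (fun p => mixed_path G u p && (size p <= k)) ps ->
  uniq [seq last u p | p <- ps].
Proof.
move=> geo ps_uniq /allP ps_path; rewrite map_inj_in_uniq // => p q.
move=> /ps_path/andP[p_path p_size] /ps_path/andP[q_path q_size] pq.
exact: (geo u _ p q).
Qed.

Lemma card_step u :
  #|[set x | step G u x]| = undirected_degree G u + out_degree G u.
Proof.
rewrite /undirected_degree /out_degree -cardsUI.
rewrite [_ :&: _](_ : _ = set0) ?cards0 ?addn0.
  by apply: eq_card => x; rewrite !inE.
by apply/setP=> x; rewrite !inE; apply/negbTE/mg_edge_not_arc.
Qed.

(** After an edge from [u] to [x], returning to [u] is the one forbidden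
continuation; after an arc, nothing is forbidden. *)
Lemma card_continuations_edge u x : mg_edge G u x ->
  undirected_degree G x + out_degree G x = #|continuations u x|.+1.
Proof.
move=> ux; rewrite -card_step (cardsD1 u) inE /step mg_edge_sym ux add1n.
congr _.+1; apply: eq_card => y; rewrite !inE mixed_path2 /step ux /=.
have [->|] := eqVneq y u; last by rewrite andbF andbT.
by rewrite mg_edge_sym ux /=.
Qed.

Lemma card_continuations_arc u x : mg_arc G u x ->
  #|continuations u x| = undirected_degree G x + out_degree G x.
Proof.
move=> ux; rewrite -card_step; apply: eq_card => y.
by rewrite !inE mixed_path2 /step ux (arc_not_edge ux) andbT.
Qed.

(** Counting the mixed paths of length at most 2 from [u]: besides the empty
one, each undirected neighbour [x] accounts for the path to [x] and at least
[r + z - 1] continuations, each out-neighbour for one more. *)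
Lemma moore_bound_at r z u :
    geodetic G 2 -> min_undirected_degree_ge G r -> min_out_degree_ge G z ->
  1 + undirected_degree G u * (r + z) + out_degree G u * (r + z).+1 <= #|V|.
Proof.
move=> geo min_r min_z.
pose S := enum [set x | step G u x].
pose ps := [::] :: [seq [:: x] | x <- S]
  ++ [seq [:: x; y] | x <- S, y <- enum (continuations u x)].
have ps_uniq : uniq ps.
  by apply: uniq_two_steps => [|x _]; apply: enum_uniq.
have ps_path : all (fun p => mixed_path G u p && (size p <= 2)) ps.
  apply/allP => p; rewrite inE => /orP[/eqP-> //|]; rewrite mem_cat => /orP[].
    by case/mapP=> x; rewrite mem_enum inE => ux ->; rewrite mixed_path1 ux.
  by case/allpairsPdep=> x [y [_]]; rewrite mem_enum inE => uxy ->; rewrite uxy.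
have := uniq_leq_size (geodetic_last_uniq geo ps_uniq ps_path)
  (fun x _ => mem_enum V x).
(* From here on, count the paths in [ps], sorted by their first step. *)
rewrite -cardT size_map /ps /= size_cat size_map size_allpairs_dep sumnE big_map.
rewrite /S -cardE big_enum /= card_step.
rewrite (bigID (mg_edge G u)) /= => le_sum.
have le_e : undirected_degree G u * (r + z).-1 <=
  \sum_(x in [set x | step G u x] | mg_edge G u x)
     size (enum (continuations u x)).
  rewrite /undirected_degree -sum_nat_const.
  rewrite [leqLHS](eq_bigl
    (fun x => (x \in [set x | step G u x]) && mg_edge G u x)); last first.
    by move=> x; rewrite !inE /step; case: (mg_edge G u x); rewrite ?andbF.
  apply: leq_sum => x /andP[_ ux]; rewrite -cardE.
  by have := card_continuations_edge ux; have := min_r x; have := min_z x; lia.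
have le_a : out_degree G u * (r + z) <=
  \sum_(x in [set x | step G u x] | ~~ mg_edge G u x)
     size (enum (continuations u x)).
  rewrite /out_degree -sum_nat_const.
  rewrite [leqLHS](eq_bigl
    (fun x => (x \in [set x | step G u x]) && ~~ mg_edge G u x)); last first.
    move=> x; rewrite !inE /step; have := mg_edge_not_arc G u x.
    by case: (mg_edge G u x); case: (mg_arc G u x).
  apply: leq_sum => x; rewrite inE /step => /andP[/orP[->//|ux] _].
  by rewrite -cardE card_continuations_arc // leq_add.
have d_r : undirected_degree G u * (r + z) <=
    undirected_degree G u * (r + z).-1 + undirected_degree G u.
  by rewrite -mulnSr leq_mul2l leqSpred orbT.
rewrite [_ * (r + z).+1]mulnS.
by move: le_sum le_e le_a d_r; set s1 := \sum_(_ <- _ | _) _;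
   set s2 := \sum_(_ <- _ | _) _; lia.
Qed.

(** The bound reads [1 + 3 * d + 4 * z <= 12], while [d >= 2] and [z >= 1]. *)
Lemma excess_one_degrees : excess_one_graph 2 1 G ->
  forall u, undirected_degree G u = 2 /\ out_degree G u = 1.
Proof.
move=> [geo min_r min_z cardV] u.
have := moore_bound_at u geo min_r min_z; rewrite cardV /moore_bound2.
by have := min_r u; have := min_z u; lia.
Qed.

End Moore.

(** * Partial descriptions of graphs *)

(** Finite lists of edges and arcs between labels that stand for vertices.
Edges are meant to be listed in both directions. *)
Definition sketch : Type := (seq (nat * nat) * seq (nat * nat))%type.

Implicit Types C : sketch.

Definition nbrs C i := [seq e.2 | e <- C.1 & e.1 == i].
Definition outs C i := [seq a.2 | a <- C.2 & a.1 == i].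
Definition succs C i := nbrs C i ++ outs C i.

Lemma mem_nbrs C i j : (j \in nbrs C i) = ((i, j) \in C.1).
Proof.
apply/mapP/idP => [[[i' j']]|ij]; first by rewrite mem_filter /= => /andP[/eqP-> ?] ->.
by exists (i, j); rewrite // mem_filter /= eqxx.
Qed.

Lemma mem_outs C i j : (j \in outs C i) = ((i, j) \in C.2).
Proof.
apply/mapP/idP => [[[i' j']]|ij]; first by rewrite mem_filter /= => /andP[/eqP-> ?] ->.
by exists (i, j); rewrite // mem_filter /= eqxx.
Qed.

(** A return [i, j, i] is kept only if it starts with an arc: it is then a mixed
path, whatever the second step is. *)
Definition short_paths C i : seq (seq nat) :=
  [::] :: [seq [:: j] | j <- succs C i] ++
  [seq [:: j; k] | j <- succs C i,
                   k <- [seq k <- succs C j | (k != i) || (j \in outs C i)]].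

Definition geodetic_at C i := uniq [seq last i p | p <- short_paths C i].

(** A conditional instead of a boolean conjunction: under call-by-value
evaluation the costly second test is then skipped when the first one fails. *)
Definition consistent C :=
  if all (fun i => size (nbrs C i) <= 2) (iota 0 12)
  then all (geodetic_at C) (iota 0 12) else false.

Lemma consistentE C :
  consistent C = all (fun i => size (nbrs C i) <= 2) (iota 0 12) &&
                 all (geodetic_at C) (iota 0 12).
Proof. by []. Qed.

(** Avoiding repeated entries matters: the tests above count neighbours, and
compare end points, by list position. *)
Definition insert (e : nat * nat) s := if e \in s then s else e :: s.

Lemma mem_insert e s : insert e s =i e :: s.
Proof.
rewrite /insert; case: ifP => // e_s f; rewrite inE.
by have [->|] := eqVneq f e.
Qed.

Lemma insert_uniq e s : uniq s -> uniq (insert e s).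
Proof. by rewrite /insert; case: ifP => //= ->. Qed.

Definition add_edge v w C : sketch :=
  (insert (v, w) (insert (w, v) C.1), C.2).
Definition add_arc v w C : sketch := (C.1, insert (v, w) C.2).

Definition label_pairs :=
  [seq ab <- [seq (a, b) | a <- iota 0 12, b <- iota 0 12] | ab.1 < ab.2].

(** The ways of choosing the two undirected neighbours of [v] so that they
include those already known. *)
Definition complete_edges v C :=
  [seq add_edge v ab.1 (add_edge v ab.2 C)
     | ab <- label_pairs & all (mem [:: ab.1; ab.2]) (nbrs C v)].

Definition complete_arc v C := [seq add_arc v w C | w <- iota 0 12].

(** [inl v] asks for the edges at [v], [inr v] for the arc out of [v]. *)
Definition task : Type := (nat + nat)%type.

Definition task_label (t : task) := match t with inl v | inr v => v end.

Definition complete (t : task) C :=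
  match t with inl v => complete_edges v C | inr v => complete_arc v C end.

(** An inconsistent sketch passes vacuously: it describes part of no graph of
the kind considered. *)
Fixpoint search (goal : pred sketch) (ts : seq task) C :=
  if consistent C then
    if ts is t :: ts' then all (search goal ts') (complete t C) else goal C
  else true.

(** * The search *)

Definition Gamma_sketch : sketch :=
  ([seq (i, i.+1 %% 12) | i <- iota 0 12] ++
   [seq (i.+1 %% 12, i) | i <- iota 0 12],
   [seq (i, (i + if odd i then 8 else 4) %% 12) | i <- iota 0 12]).

(** Entry [x] of [s] is the label that plays the role of vertex [x] of Gamma. *)
Definition is_copy (s : seq nat) C :=
  let rename := fun e => (nth 0 s e.1, nth 0 s e.2) in
  [&& size s == 12, uniq s, all (mem C.1) (map rename Gamma_sketch.1)
    & all (mem C.2) (map rename Gamma_sketch.2)].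

(** The copies of Gamma that extend the tree with root 0.  The neighbours 1
and 11 of vertex 0 of Gamma get the labels 1 and 2, and the neighbours 3 and 5
of its vertex 4 get the labels 8 and 9, each pair in either order; the other
entries are forced. *)
Definition candidate_copies : seq (seq nat) :=
  [:: [:: 0; 1; 4; 8; 3; 9; 11; 7; 10; 5; 6; 2];
      [:: 0; 1; 4; 9; 3; 8; 11; 7; 10; 5; 6; 2];
      [:: 0; 2; 6; 8; 3; 9; 11; 5; 10; 7; 4; 1];
      [:: 0; 2; 6; 9; 3; 8; 11; 5; 10; 7; 4; 1]].

(** The steps of the eleven short paths from vertex 0, numbered level by level
with edges before arcs; label 11 occurs in none of them. *)
Definition tree_sketch : sketch :=
  foldr (fun e => add_edge e.1 e.2)
    ([::], [:: (0, 3); (1, 5); (2, 7); (3, 10)])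
    [:: (0, 1); (0, 2); (1, 4); (2, 6); (3, 8); (3, 9)].

(** Edges come first because guessing them first keeps the search small: the
undirected degrees leave few ways to place them. *)
Definition tasks : seq task :=
  map inl (iota 4 8) ++ map inr (iota 4 8).

Lemma search_tree :
  search (fun C => has (is_copy^~ C) candidate_copies)
         tasks tree_sketch.
Proof. by vm_compute. Qed.

(** * Gamma is an excess one graph *)

Lemma Gamma_edge_sketch (x y : 'Z_12) :
  Gamma_edge x y -> (x : nat, y : nat) \in Gamma_sketch.1.
Proof.
by move=> /orP[] /eqP->; [case: x|case: y]; do 12?[case=> //].
Qed.

Lemma Gamma_arc_sketch (x y : 'Z_12) :
  Gamma_arc x y -> (x : nat, y : nat) \in Gamma_sketch.2.
Proof. by move=> /eqP->; case: x; do 12?[case=> //]. Qed.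

Lemma Gamma_undirected_degree x : undirected_degree Gamma x = 2.
Proof.
rewrite /undirected_degree [[set v | _]](_ : _ = [set (x + 1)%R; (x - 1)%R]).
  by rewrite cards2; case: x; do 12?[case=> //].
apply/setP=> y; rewrite !inE /= /Gamma_edge; congr (_ || _).
by rewrite [RHS]eq_sym GRing.subr_eq.
Qed.

Lemma Gamma_out_degree x : out_degree Gamma x = 1.
Proof.
rewrite /out_degree [[set v | _]](_ : _ = [set if odd x then (x - 4)%R else (x + 4)%R]).
  by rewrite cards1.
by apply/setP=> y; rewrite !inE.
Qed.

Lemma Gamma_sketch_consistent : consistent Gamma_sketch.
Proof. by vm_compute. Qed.

Lemma Gamma_short_paths (u : 'Z_12) p :
    mixed_path Gamma u p -> size p <= 2 ->
  [seq val x | x <- p] \in short_paths Gamma_sketch (val u).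
Proof.
have succP (x y : 'Z_12) :
    step Gamma x y -> (y : nat) \in succs Gamma_sketch x.
  rewrite mem_cat mem_nbrs mem_outs => /orP[xy|xy].
    by rewrite Gamma_edge_sketch.
  by rewrite Gamma_arc_sketch ?orbT.
case: p => [|x [|y [|//]]] //.
  rewrite mixed_path1 => /succP ux _.
  by rewrite inE mem_cat (map_f (fun j => [:: j])) ?orbT.
rewrite mixed_path2 => /and3P[ux xy nbt] _.
rewrite inE mem_cat; apply/or3P/Or33.
apply/allpairsPdep; exists (val x), (val y); split=> //; first exact: succP.
rewrite mem_filter succP // andbT mem_outs.
(* A return to [u] is non-backtracking, so its first step is an arc. *)
have [y_u|//] := eqVneq (val y) (val u).
move: nbt; rewrite (val_inj y_u) eqxx andbT mg_edge_sym andbb => /negbTE ux'.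
by move: ux; rewrite /step mg_edge_sym ux' => /Gamma_arc_sketch.
Qed.

Lemma Gamma_geodetic : geodetic Gamma 2.
Proof.
move=> u v p q p_path p_last p_size q_path q_last q_size.
have := Gamma_sketch_consistent; rewrite consistentE => /andP[_].
move=> /allP/(_ (val u)); rewrite mem_iota ltn_ord => /(_ isT)/uniq_map_inj_in inj_u.
apply/(inj_map val_inj)/inj_u; try exact: Gamma_short_paths.
by rewrite !last_map p_last q_last.
Qed.

Lemma Gamma_excess_one : excess_one_graph 2 1 Gamma.
Proof.
split; first exact: Gamma_geodetic.
- by move=> x; rewrite Gamma_undirected_degree.
- by move=> x; rewrite Gamma_out_degree.
- by rewrite card_ord.
Qed.

(** * Uniqueness *)

(** The neighbours of [x] inject into those of [f x], and there are at least
as many of them, so no edge or arc at [f x] comes from elsewhere. *)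
Lemma bijective_hom_isomorphic (V W : finType) (G : mixed_graph V)
    (H : mixed_graph W) (f : W -> V) :
    injective f -> #|V| <= #|W| ->
    (forall x y, mg_edge H x y -> mg_edge G (f x) (f y)) ->
    (forall x y, mg_arc H x y -> mg_arc G (f x) (f y)) ->
    (forall x, undirected_degree G (f x) <= undirected_degree H x) ->
    (forall x, out_degree G (f x) <= out_degree H x) ->
  isomorphic G H.
Proof.
move=> f_inj VW f_edge f_arc edge_le arc_le.
have reflects (e : rel W) (e' : rel V) x :
    (forall y, e x y -> e' (f x) (f y)) ->
    #|[set v | e' (f x) v]| <= #|[set y | e x y]| ->
  forall y, e' (f x) (f y) = e x y.
  move=> hom le_card y.
  have /eqP im : [set f y | y in [set y | e x y]] == [set v | e' (f x) v].
    rewrite eqEcard card_imset // le_card andbT.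
    by apply/subsetP=> _ /imsetP[y' + ->]; rewrite !inE; apply: hom.
  by move/setP: im => /(_ (f y)); rewrite mem_imset // !inE.
have [g fK gK] := inj_card_bij f_inj VW.
exists g; split; first by exists f.
- move=> u v; rewrite -{2}(gK u) -{2}(gK v); apply/esym/reflects => [y|].
    exact: f_edge.
  exact: edge_le.
- move=> u v; rewrite -{2}(gK u) -{2}(gK v); apply/esym/reflects => [y|].
    exact: f_arc.
  exact: arc_le.
Qed.

Section Labelling.

Variables (V : finType) (G : mixed_graph V) (lab : nat -> V).
Hypothesis lab_inj : {in gtn 12 &, injective lab}.
Hypothesis lab_surj : forall v, exists2 i, i < 12 & lab i = v.
Hypothesis geoG : geodetic G 2.
Hypothesis edge_degree : forall u, undirected_degree G u = 2.
Hypothesis arc_degree : forall u, out_degree G u = 1.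

(** The sketch is correct for [G] under the labelling, though possibly
incomplete: nothing is claimed about pairs that it does not list. *)
Definition realises C :=
  [/\ uniq C.1 && uniq C.2,
      forall i j, (i, j) \in C.1 ->
        [/\ i < 12, j < 12 & mg_edge G (lab i) (lab j)]
    & forall i j, (i, j) \in C.2 ->
        [/\ i < 12, j < 12 & mg_arc G (lab i) (lab j)]].

Lemma realises_succs C i j : realises C -> j \in succs C i ->
  [/\ i < 12, j < 12 & step G (lab i) (lab j)].
Proof.
move=> [_ C_edge C_arc]; rewrite mem_cat mem_nbrs mem_outs /step.
by case/orP=> [/C_edge|/C_arc] [-> -> ->]; rewrite ?orbT.
Qed.

Lemma realises_short_paths C i p :
    i < 12 -> realises C -> p \in short_paths C i ->
  [/\ mixed_path G (lab i) (map lab p), size p <= 2 & all (gtn 12) p].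
Proof.
move=> i12 realC; rewrite inE mem_cat => /or3P[/eqP-> //|/mapP[j ij ->]|].
  by have [_ /= -> ij'] := realises_succs realC ij; rewrite mixed_path1.
move=> /allpairsPdep[j [k [ij]]].
rewrite mem_filter => /andP[no_back jk] ->.
have [_ j12 ij'] := realises_succs realC ij.
have [_ k12 jk'] := realises_succs realC jk.
split=> //=; last by rewrite j12 k12.
rewrite mixed_path2 ij' jk' /=; apply/negP=> /and3P[e_ij _ /eqP k_i].
case/orP: no_back => [|]; first by rewrite (lab_inj _ _ k_i) // eqxx.
case: realC => _ _ C_arc; rewrite mem_outs => /C_arc[_ _ a_ij].
by rewrite (arc_not_edge a_ij) in e_ij.
Qed.

Lemma uniq_short_paths C i : realises C -> uniq (short_paths C i).
Proof.
move=> [/andP[C1_uniq C2_uniq] C_edge C_arc].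
have row_uniq (s : seq (nat * nat)) k : uniq s ->
    uniq [seq e.2 | e <- s & e.1 == k].
  move=> s_uniq; rewrite map_inj_in_uniq ?filter_uniq // => -[a b] [a' b'].
  by rewrite !mem_filter /= => /andP[/eqP-> _] /andP[/eqP-> _] ->.
have succs_uniq k : uniq (succs C k).
  rewrite cat_uniq !row_uniq //= andbT; apply/hasPn => j.
  rewrite mem_outs => /C_arc[_ _ kj] /=; rewrite mem_nbrs.
  by apply/negP => /C_edge[_ _]; rewrite arc_not_edge.
by apply: uniq_two_steps => // j _; rewrite filter_uniq.
Qed.

(** Short paths of the sketch are short paths of [G], so a repeated end point
in the sketch would contradict the geodetic property; likewise a label with
three neighbours would contradict the degree. *)
Lemma realises_consistent C : realises C -> consistent C.
Proof.
move=> realC; have [_ C_edge _] := realC.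
rewrite consistentE; apply/andP; split; apply/allP => i;
  rewrite mem_iota => /= i12.
  rewrite -(edge_degree (lab i)) /undirected_degree -(size_map lab).
  have nbrs_edge j : j \in nbrs C i -> j < 12 /\ mg_edge G (lab i) (lab j).
    by rewrite mem_nbrs => /C_edge[].
  rewrite cardE; apply: uniq_leq_size.
    rewrite map_inj_in_uniq => [|j k].
      have := uniq_short_paths i realC.
      rewrite /= cat_uniq map_inj_uniq => [/and4P[_ + _ _]|x y [] //].
      by rewrite cat_uniq => /andP[].
    by move=> /nbrs_edge[j12 _] /nbrs_edge[k12 _]; apply: lab_inj.
  by move=> _ /mapP[j /nbrs_edge[_ ij] ->]; rewrite mem_enum inE.
rewrite /geodetic_at map_inj_in_uniq ?uniq_short_paths // => p q.
move=> /(realises_short_paths i12 realC)[p_path p_size p12].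
move=> /(realises_short_paths i12 realC)[q_path q_size q12] pq.
apply/(inj_in_map lab_inj) => //.
apply: (geoG p_path erefl _ q_path); rewrite ?size_map //.
by rewrite !last_map pq.
Qed.

(** Since all vertices carry labels, the actual out-neighbour is among the
guesses. *)
Lemma complete_arc_sound v C : v < 12 -> realises C ->
  exists2 C', C' \in complete_arc v C & realises C'.
Proof.
move=> v12 [/andP[C1_uniq C2_uniq] C_edge C_arc].
have /card_gt0P[x] : 0 < #|[set x | mg_arc G (lab v) x]|.
  by rewrite -/(out_degree _ _) arc_degree.
rewrite inE; have [w w12 <-] := lab_surj x => vw.
exists (add_arc v w C); first by apply/mapP; exists w; rewrite ?mem_iota.
split=> [||i j]; [by rewrite C1_uniq insert_uniq | exact: C_edge |].
by rewrite mem_insert inE => /predU1P[[-> ->] //|]; exact: C_arc.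
Qed.

Lemma realises_add_edge v w C : v < 12 -> w < 12 ->
  mg_edge G (lab v) (lab w) -> realises C -> realises (add_edge v w C).
Proof.
move=> v12 w12 vw [/andP[C1_uniq C2_uniq] C_edge C_arc].
split=> [|i j|]; [by rewrite !insert_uniq | | exact: C_arc].
rewrite !(mem_insert, inE) => /or3P[/eqP[-> ->] //|/eqP[-> ->]|].
  by rewrite mg_edge_sym.
exact: C_edge.
Qed.

Lemma complete_edges_sound v C : v < 12 -> realises C ->
  exists2 C', C' \in complete_edges v C & realises C'.
Proof.
move=> v12 realC.
have /eqP/cards2P[x [y [xy]]] := edge_degree (lab v).
have [a a12 ax] := lab_surj x; have [b b12 yb] := lab_surj y.
rewrite -{}ax -{}yb in xy * => /setP N_v {x y}.
have edge_v j : mg_edge G (lab v) (lab j) = (lab j == lab a) || (lab j == lab b).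
  by have := N_v (lab j); rewrite !inE.
have nbrs_v j : j \in nbrs C v -> (j == a) || (j == b).
  case: realC => _ C_edge _; rewrite mem_nbrs => /C_edge[_ j12]; rewrite edge_v.
  by case/orP=> /eqP/lab_inj-> //; rewrite eqxx ?orbT.
have va : mg_edge G (lab v) (lab a) by rewrite edge_v eqxx.
have vb : mg_edge G (lab v) (lab b) by rewrite edge_v eqxx orbT.
(* The guesses are unordered pairs, listed increasingly. *)
wlog ab : a b a12 b12 xy nbrs_v va vb {N_v edge_v} / a < b.
  move=> ordered; have [ab|ba|ab] := ltngtP a b; last by rewrite ab eqxx in xy.
    exact: (ordered a b).
  by apply: (ordered b a) => //; [rewrite eq_sym | move=> j; rewrite orbC; auto].
exists (add_edge v a (add_edge v b C)); last by do 2?apply: realises_add_edge.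
apply/mapP; exists (a, b) => //; rewrite mem_filter; apply/andP; split.
  by apply/allP=> j /nbrs_v; rewrite /= !inE.
rewrite mem_filter; apply/andP; split; first exact: ab.
by apply/allpairsP; exists (a, b); rewrite !mem_iota.
Qed.

(** Following at each task the guess that is true in [G] leads through
consistent sketches only, hence to a leaf where [goal] holds. *)
Lemma search_sound goal ts C :
    all (fun t => task_label t < 12) ts -> realises C -> search goal ts C ->
  exists2 C', realises C' & goal C'.
Proof.
elim: ts C => [|t ts IHts] C /=.
  by move=> _ realC; rewrite realises_consistent //; exists C.
move=> /andP[t12 ts12] realC; rewrite realises_consistent // => /allP found.
have [C' C'_in realC'] : exists2 C', C' \in complete t C & realises C'.
  case: t t12 {found} => v v12; first exact: complete_edges_sound.
  exact: complete_arc_sound.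
exact: IHts (found _ C'_in).
Qed.

Lemma copy_isomorphic s C : realises C -> is_copy s C -> isomorphic G Gamma.
Proof.
move=> [_ C_edge C_arc] /and4P[/eqP s_size s_uniq /allP s_edge /allP s_arc].
pose f (x : 'Z_12) := lab (nth 0 s x).
have f_edge x y : mg_edge Gamma x y -> nth 0 s x < 12 /\ mg_edge G (f x) (f y).
  move=> /Gamma_edge_sketch/(map_f (fun e => (nth 0 s e.1, nth 0 s e.2))).
  by move=> /s_edge/C_edge[].
have f_arc x y : mg_arc Gamma x y -> mg_arc G (f x) (f y).
  move=> /Gamma_arc_sketch/(map_f (fun e => (nth 0 s e.1, nth 0 s e.2))).
  by move=> /s_arc/C_arc[].
have s12 (x : 'Z_12) : nth 0 s x < 12.
  apply: (f_edge x (x + 1)%R _).1; by rewrite /= /Gamma_edge eqxx.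
apply: (@bijective_hom_isomorphic _ _ _ _ f).
- move=> x y eq_xy; have /eqP := lab_inj (s12 x) (s12 y) eq_xy.
  by rewrite nth_uniq ?s_size // => /eqP/val_inj.
- rewrite card_ord -(size_iota 0 12) -(size_map lab) cardT.
  apply: uniq_leq_size (enum_uniq _) _ => v _; have [i i12 <-] := lab_surj v.
  by rewrite map_f // mem_iota.
- by move=> x y /f_edge[].
- exact: f_arc.
- by move=> x; rewrite edge_degree Gamma_undirected_degree.
- by move=> x; rewrite arc_degree Gamma_out_degree.
Qed.

End Labelling.

Lemma other_neighbour (V : finType) (G : mixed_graph V) u w :
  1 < undirected_degree G u -> exists2 x, mg_edge G u x & x != w.
Proof.
move=> u_deg; have /card_gt0P[x] : 0 < #|[set x | mg_edge G u x] :\ w|.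
  by move: u_deg; rewrite /undirected_degree (cardsD1 w) /=; lia.
by rewrite !inE => /andP[x_w ux]; exists x.
Qed.

(** Eleven distinct short paths from a vertex reach eleven distinct vertices;
label 11 goes to the remaining one. *)
Lemma tree_labelling (V : finType) (G : mixed_graph V) :
    excess_one_graph 2 1 G ->
  exists lab : nat -> V,
    [/\ {in gtn 12 &, injective lab},
        forall v, exists2 i, i < 12 & lab i = v
      & realises G lab tree_sketch].
Proof.
move=> [geo min_edge min_arc cardV].
have out u : exists x, mg_arc G u x.
  by have /card_gt0P[x] := min_arc u; rewrite inE; exists x.
have nbr u w := other_neighbour w (min_edge u).
have [u _] : exists u, u \in V by apply/card_gt0P; rewrite cardV.
have [v1 e1 _] := nbr u u; have [v2 e2 v21] := nbr u v1.
have [v3 a3] := out u.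
have [v4 e4 v4u] := nbr v1 u; have [v5 a5] := out v1.
have [v6 e6 v6u] := nbr v2 u; have [v7 a7] := out v2.
have [v8 e8 _] := nbr v3 v3; have [v9 e9 v98] := nbr v3 v8.
have [v10 a10] := out v3.
pose ps := [:: [::]; [:: v1]; [:: v2]; [:: v3]; [:: v1; v4]; [:: v1; v5];
  [:: v2; v6]; [:: v2; v7]; [:: v3; v8]; [:: v3; v9]; [:: v3; v10]].
have ps_uniq : uniq ps.
  rewrite /= !inE /= !eqseq_cons !eqxx /= !andbT.
  rewrite (eq_sym v1 v2) (negPf v21) (negPf (edge_neq_arc e1 a3)).
  rewrite (negPf (edge_neq_arc e2 a3)) (negPf (edge_neq_arc e4 a5)).
  rewrite (negPf (edge_neq_arc e6 a7)) (eq_sym v8 v9) (negPf v98).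
  by rewrite (negPf (edge_neq_arc e8 a10)) (negPf (edge_neq_arc e9 a10))
    /= !andbF.
have ps_path : all (fun p => mixed_path G u p && (size p <= 2)) ps.
  rewrite /= !mixed_path1 !mixed_path2 /step.
  rewrite !e1 !e2 !e4 !e6 !e8 !e9 !a3 !a5 !a7 !a10 !(arc_not_edge a3).
  by rewrite !(arc_not_edge a5) !(arc_not_edge a7) (negPf v4u) (negPf v6u) !orbT.
have := geodetic_last_uniq geo ps_uniq ps_path.
set vs := map _ _ => vs_uniq.
have /card_gt0P[v11] : 0 < #|~: [set v in vs]|.
  by rewrite cardsCs setCK cardV cardsE (card_uniqP vs_uniq).
rewrite in_setC in_set => v11_vs.
pose labs := rcons vs v11; have labs_uniq : uniq labs.
  by rewrite rcons_uniq v11_vs.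
exists (nth u labs); split.
- move=> i j i12 j12 /eqP; rewrite nth_uniq // => /eqP //.
- move=> v; have [_ full] : (size labs = size (enum V)) * (labs =i enum V).
    apply: uniq_min_size => // [w _|]; first by rewrite mem_enum.
    by rewrite -cardT cardV.
  have v_labs : v \in labs by rewrite full mem_enum.
  by exists (index v labs); [rewrite -index_mem in v_labs | rewrite nth_index].
- do 6![apply: realises_add_edge => //].
  by split=> // i j; rewrite !inE; do 3?case/orP; move=> /eqP[-> ->].
Qed.

Theorem theorem6p3 :
  excess_one_graph 2 1 Gamma /\
  (forall (V : finType) (G : mixed_graph V),
     excess_one_graph 2 1 G -> isomorphic G Gamma).
Proof.
split; first exact: Gamma_excess_one.
move=> V G exG; have degrees := excess_one_degrees exG.
have [lab [lab_inj lab_surj realT]] := tree_labelling exG.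
have [geo _ _ _] := exG.
have edge_degree u : undirected_degree G u = 2 by case: (degrees u).
have arc_degree u : out_degree G u = 1 by case: (degrees u).
have [C realC /hasP[s _]] := search_sound lab_inj lab_surj geo edge_degree
  arc_degree (isT : all (fun t => task_label t < 12) tasks) realT search_tree.
exact: (copy_isomorphic lab_inj lab_surj edge_degree arc_degree realC).
Qed.
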